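(* Let $\mathcal{X}\subset\mathbb{R}^d$ be nonempty, convex and compact with diameter at most $D$ (i.e. $\|\mathbf{x}-\mathbf{y}\|\le D$ for all $\mathbf{x},\mathbf{y}\in\mathcal{X}$), and let $f:\mathcal{X}\to\mathbb{R}$ be convex and differentiable with $L$-Lipschitz gradient on $\mathcal{X}$, i.e. $\|\nabla f(\mathbf{x})-\nabla f(\mathbf{y})\|_*\le L\|\mathbf{x}-\mathbf{y}\|$ for all $\mathbf{x},\mathbf{y}\in\mathcal{X}$. Run Frank-Wolfe with heavy ball momentum (HFW) with $\delta_k=\eta_k=\frac{2}{k+2}$ for all $k\ge 0$. Then the generalized FW gap satisfies $$\mathcal{G}_k=f(\mathbf{x}_k)-\Phi_k(\mathbf{v}_k)\le\frac{2LD^2}{k+1},\qquad\forall k\ge 1.$$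
   Context: $\|\cdot\|$ is a norm on $\mathbb{R}^d$, $\|\cdot\|_*$ its dual norm, $\langle\cdot,\cdot\rangle$ the inner product. HFW with parameters $\delta_k,\eta_k\in[0,1]$: start from any $\mathbf{x}_0\in\mathcal{X}$ and $\mathbf{g}_0=\nabla f(\mathbf{x}_0)$; for $k=0,1,2,\dots$ set $\mathbf{g}_{k+1}=(1-\delta_k)\mathbf{g}_k+\delta_k\nabla f(\mathbf{x}_k)$, let $\mathbf{v}_{k+1}$ be any element of $\arg\min_{\mathbf{v}\in\mathcal{X}}\langle\mathbf{g}_{k+1},\mathbf{v}\rangle$, and set $\mathbf{x}_{k+1}=(1-\eta_k)\mathbf{x}_k+\eta_k\mathbf{v}_{k+1}$. Weights: $w_k^\tau=\delta_\tau\prod_{j=\tau+1}^k(1-\delta_j)$ for $1\le\tau\le k$ and $w_k^0=\prod_{j=1}^k(1-\delta_j)$ (empty products equal $1$), so that $\mathbf{g}_{k+1}=\sum_{\tau=0}^k w_k^\tau\nabla f(\mathbf{x}_\tau)$. For $k\ge 0$ define $$\Phi_{k+1}(\mathbf{x})=\sum_{\tau=0}^k w_k^\tau\big[f(\mathbf{x}_\tau)+\langle\nabla f(\mathbf{x}_\tau),\mathbf{x}-\mathbf{x}_\tau\rangle\big].$$ The generalized FW gap is, for $k\ge 1$, $\mathcal{G}_k=f(\mathbf{x}_k)-\min_{\mathbf{x}\in\mathcal{X}}\Phi_k(\mathbf{x})=f(\mathbf{x}_k)-\Phi_k(\mathbf{v}_k)$. *)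

(* Defs.v *)
From HB Require Import structures.
From mathcomp Require Import all_boot all_order all_algebra.
From mathcomp Require Import all_classical all_reals all_analysis.

Set Implicit Arguments.
Unset Strict Implicit.
Unset Printing Implicit Defensive.

Import Order.TTheory GRing.Theory Num.Theory.
Import numFieldNormedType.Exports.

Local Open Scope classical_set_scope.
Local Open Scope ring_scope.

(* The norm of the problem is an arbitrary norm [N] on 'rV[R]_d. The library's
   norm on 'rV[R]_d (the sup norm) is used only for topological notions
   (compactness, little-o), for which all norms on R^d are equivalent. *)

Definition dotv {R : realType} {d : nat} (u v : 'rV[R]_d) : R :=
  \sum_(i < d) u 0 i * v 0 i.

Definition is_norm {R : realType} {d : nat} (N : 'rV[R]_d -> R) : Prop :=
  [/\ forall u v, N (u + v) <= N u + N v,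
      forall (a : R) u, N (a *: u) = `|a| * N u
    & forall u, N u = 0 -> u = 0].

Definition dual_norm {R : realType} {d : nat} (N : 'rV[R]_d -> R)
    (g : 'rV[R]_d) : R :=
  sup [set dotv g u | u in [set u | N u <= 1]].

(* [f] is differentiable as a function on [X], with gradient [df]: the limit is
   taken along points of [X], so values of [f] outside [X] play no role. At an
   interior point of [X] this is ordinary differentiability. If [X] has empty
   interior, [df x] is not determined by [f]; any choice is allowed. *)
Definition gradient_on {R : realType} {d : nat} (X : set 'rV[R]_d)
    (f : 'rV[R]_d -> R^o) (df : 'rV[R]_d -> 'rV[R]_d) : Prop :=
  forall x, X x ->
    let F := within X (nbhs x) in
    (fun y => f y - f x - dotv (df x) (y - x)) =o_F (fun y => y - x).

Definition lipschitz_gradient_on {R : realType} {d : nat}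
    (N : 'rV[R]_d -> R) (X : set 'rV[R]_d) (L : R)
    (df : 'rV[R]_d -> 'rV[R]_d) : Prop :=
  forall x y, X x -> X y -> dual_norm N (df x - df y) <= L * N (x - y).

Definition argmin_on {R : realType} {T : Type} (X : set T) (h : T -> R) :
    set T :=
  [set v | X v /\ forall u, X u -> h v <= h u].

(* [v 0] is unconstrained: the vertices are indexed from 1. *)
Definition HFW {R : realType} {d : nat} (X : set 'rV[R]_d)
    (df : 'rV[R]_d -> 'rV[R]_d) (delta eta : nat -> R)
    (x g v : nat -> 'rV[R]_d) : Prop :=
  [/\ X (x 0%N), g 0%N = df (x 0%N)
    & forall k : nat,
      [/\ g k.+1 = (1 - delta k) *: g k + delta k *: df (x k),
          argmin_on X (dotv (g k.+1)) (v k.+1)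
        & x k.+1 = (1 - eta k) *: x k + eta k *: v k.+1]].

(* [weight delta k tau] is $w_k^\tau$. *)
Definition weight {R : realType} (delta : nat -> R) (k tau : nat) : R :=
  if tau == 0%N then \prod_(1 <= j < k.+1) (1 - delta j)
  else delta tau * \prod_(tau.+1 <= j < k.+1) (1 - delta j).

(* [Phi f df delta x k] is $\Phi_k$, meaningful for [0 < k] only; its weights
   are the $w_{k-1}^\tau$. *)
Definition Phi {R : realType} {d : nat} (f : 'rV[R]_d -> R)
    (df : 'rV[R]_d -> 'rV[R]_d) (delta : nat -> R) (x : nat -> 'rV[R]_d)
    (k : nat) (y : 'rV[R]_d) : R :=
  \sum_(0 <= tau < k)
    weight delta k.-1 tau * (f (x tau) + dotv (df (x tau)) (y - x tau)).

(* The infimum is a minimum: [Phi] is affine in [y] and [X] is compact. *)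
Definition FW_gap {R : realType} {d : nat} (X : set 'rV[R]_d)
    (f : 'rV[R]_d -> R) (df : 'rV[R]_d -> 'rV[R]_d) (delta : nat -> R)
    (x : nat -> 'rV[R]_d) (k : nat) : R :=
  f (x k) - inf [set Phi f df delta x k y | y in X].

(* Main.v *)
Require Import Defs.
From HB Require Import structures.
From mathcomp Require Import all_boot all_order all_algebra.
From mathcomp Require Import all_classical all_reals all_analysis.
From mathcomp Require Import ring lra.

Set Implicit Arguments.
Unset Strict Implicit.

Import Order.TTheory GRing.Theory Num.Theory.
Import numFieldNormedType.Exports.

Local Open Scope classical_set_scope.
Local Open Scope ring_scope.

(* The linearized models satisfy
     Phi_(k+1) = (1 - delta_k) Phi_k + delta_k l_k,
   where l_k is the linearization of f at x_k, and v_(k+1) minimizes Phi_(k+1)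
   over X.  Smoothness along the segment from x_k to x_(k+1) gives, when
   eta_k = delta_k,
     f(x_(k+1)) <= (1 - delta_k) f(x_k) + delta_k l_k(v_(k+1))
                   + (L D^2 / 2) delta_k^2.
   Subtracting Phi_(k+1)(v_(k+1)) and using Phi_k(v_(k+1)) >= Phi_k(v_k) yields
     G_(k+1) <= (1 - delta_k) G_k + (L D^2 / 2) delta_k^2,
   whence the bound by induction; delta_0 = 1 provides the base case. *)

(** * Bilinearity of the inner product and its comparison with the sup norm *)

Section dot_product.
Context {R : realType} {d : nat}.
Implicit Types u v w : 'rV[R]_d.

Lemma dotvDl u v w : dotv (u + v) w = dotv u w + dotv v w.
Proof.
by rewrite /dotv -big_split/=; apply: eq_bigr => i _; rewrite mxE mulrDl.
Qed.

Lemma dotvDr w u v : dotv w (u + v) = dotv w u + dotv w v.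
Proof.
by rewrite /dotv -big_split/=; apply: eq_bigr => i _; rewrite mxE mulrDr.
Qed.

Lemma dotvZl a u v : dotv (a *: u) v = a * dotv u v.
Proof.
by rewrite /dotv mulr_sumr; apply: eq_bigr => i _; rewrite mxE mulrA.
Qed.

Lemma dotvZr a u v : dotv u (a *: v) = a * dotv u v.
Proof.
by rewrite /dotv mulr_sumr; apply: eq_bigr => i _; rewrite mxE mulrCA.
Qed.

Lemma dotvBl u v w : dotv (u - v) w = dotv u w - dotv v w.
Proof. by rewrite dotvDl -scaleN1r dotvZl mulN1r. Qed.

Lemma dotvBr w u v : dotv w (u - v) = dotv w u - dotv w v.
Proof. by rewrite dotvDr -scaleN1r dotvZr mulN1r. Qed.

Lemma dotv0r u : dotv u 0 = 0.
Proof. by rewrite -(scale0r 0) dotvZr mul0r. Qed.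

Lemma ler_rV_norm u i : `|u 0 i| <= `|u|.
Proof.
rewrite [leRHS]/Num.norm/= mx_normrE; apply/bigmax_geP; right.
by exists (0, i).
Qed.

Lemma ler_dotv u v : dotv u v <= (\sum_i `|u 0 i|) * `|v|.
Proof.
rewrite mulr_suml; apply: ler_sum => i _.
rewrite (le_trans (ler_norm _))// normrM.
by rewrite ler_wpM2l// ler_rV_norm.
Qed.

End dot_product.

(** * Equivalence of [N] with the sup norm, and the duality inequality *)

Section arbitrary_norm.
Context {R : realType} {d : nat} {N : 'rV[R]_d -> R} (hN : is_norm N).
Implicit Types u v : 'rV[R]_d.

Lemma is_normD u v : N (u + v) <= N u + N v.
Proof. by case: hN. Qed.

Lemma is_normZ a u : N (a *: u) = `|a| * N u.
Proof. by case: hN. Qed.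

Lemma is_norm0_eq0 u : N u = 0 -> u = 0.
Proof. by case: hN => _ _; exact. Qed.

Lemma is_norm0 : N 0 = 0.
Proof. by rewrite -(scale0r 0) is_normZ normr0 mul0r. Qed.

Lemma is_normN u : N (- u) = N u.
Proof. by rewrite -scaleN1r is_normZ normrN1 mul1r. Qed.

Lemma is_norm_ge0 u : 0 <= N u.
Proof.
by have := is_normD u (- u); rewrite subrr is_norm0 is_normN; lra.
Qed.

(** Expand [u] in the standard basis and apply the triangle inequality; [K] is the sum of the norms
    of the basis vectors. *)
Lemma is_norm_le_mx_norm : exists2 K : R, 0 <= K & forall u, N u <= K * `|u|.
Proof.
exists (\sum_i N (delta_mx 0 i)).
  by apply: sumr_ge0 => i _; exact: is_norm_ge0.
move=> u; rewrite {1}(row_sum_delta u) mulr_suml.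
apply: (@big_ind2 _ _ (fun v a => N v <= a)).
- by rewrite is_norm0.
- by move=> u1 a1 u2 a2 h1 h2; exact: le_trans (is_normD _ _) (lerD h1 h2).
- move=> i _; rewrite is_normZ mulrC ler_wpM2l ?is_norm_ge0//.
  exact: ler_rV_norm.
Qed.

Lemma is_norm_continuous : continuous N.
Proof.
have [K K0 NK] := is_norm_le_mx_norm.
move=> u; apply/(@cvgrPdist_le _ _ _ (nbhs u)) => e e0.
have K1 : 0 < K + 1 by lra.
near=> v.
have lipN : `|N u - N v| <= N (u - v).
  have h1 := is_normD (u - v) v; have h2 := is_normD (v - u) u.
  rewrite !subrK in h1 h2; rewrite -[v - u]opprB is_normN in h2.
  by rewrite ler_norml; apply/andP; split; lra.
rewrite (le_trans lipN)// (le_trans (NK _))//.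
apply: (@le_trans _ _ ((K + 1) * `|u - v|)).
  by rewrite ler_wpM2r// lerDl.
rewrite -ler_pdivlMl// mulrC.
near: v; have /cvgrPdist_le : v @[v --> u] --> u by exact: cvg_id.
by apply; exact: divr_gt0.
Unshelve. all: by end_near. Qed.

(** The continuous [N] attains a positive minimum [c] on the compact sup-norm unit sphere;
    homogeneity extends the bound to all vectors. *)
Lemma mx_norm_le_is_norm : exists2 c : R, 0 < c & forall u, c * `|u| <= N u.
Proof.
pose S := [set u : 'rV[R]_d | `|u| = 1].
(* The sphere is empty only when every vector is zero ([d = 0]), and then any constant works. *)
have [[u0 Su0]|S0] := pselect (S !=set0); last first.
  exists 1 => // u; have [->|u0] := eqVneq u 0.
    by rewrite normr0 mulr0 is_norm0.
  exfalso; apply: S0; exists (`|u|^-1 *: u).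
  by rewrite /S/= normrZ normfV normr_id mulVf// normr_eq0.
have cS : compact S.
  apply: bounded_closed_compact.
    by exists 1; split => // M M1 u /= ->; exact: ltW.
  have -> : S = Num.norm @^-1` [set 1 : R] by [].
  apply: closed_comp; last exact: closed_eq.
  by move=> u _; exact: norm_continuous.
have cN : {within S, continuous N}.
  by apply: continuous_subspaceT; exact: is_norm_continuous.
have [m mS Nm] := EVT_min_rV (ex_intro _ u0 Su0) cS cN.
rewrite inE /S/= in mS.
have Nm0 : 0 < N m.
  rewrite lt_neqAle is_norm_ge0 andbT eq_sym; apply/eqP => /is_norm0_eq0 m0.
  by move: mS; rewrite m0 normr0 => /esym/eqP; rewrite oner_eq0.
exists (N m) => // u; have [->|un0] := eqVneq u 0.
  by rewrite normr0 mulr0 is_norm0.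
have u_gt0 : 0 < `|u| by rewrite normr_gt0.
rewrite -ler_pdivlMr// mulrC.
have -> : `|u|^-1 * N u = N (`|u|^-1 *: u).
  by rewrite is_normZ normfV normr_id.
by apply: Nm; rewrite inE /S/= normrZ normfV normr_id mulVf// gt_eqF.
Qed.

(* The supremum defining [dual_norm N g] is over a bounded set, hence not the
   junk value [0], because [N] dominates the library's norm. *)
Lemma dotv_le_dual_norm g u : dotv g u <= dual_norm N g * N u.
Proof.
have [->|un0] := eqVneq u 0; first by rewrite dotv0r is_norm0 mulr0.
have Nu0 : 0 < N u.
  rewrite lt_neqAle is_norm_ge0 andbT eq_sym; apply/eqP => /is_norm0_eq0 u0.
  by rewrite u0 eqxx in un0.
rewrite -ler_pdivrMr// mulrC -dotvZr; apply: ub_le_sup; last first.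
  exists ((N u)^-1 *: u) => //=.
  by rewrite is_normZ gtr0_norm ?invr_gt0// mulVf// gt_eqF.
have [c c0 cN] := mx_norm_le_is_norm.
exists ((\sum_i `|g 0 i|) * c^-1) => _ [w /= Nw <-].
apply: le_trans (ler_dotv _ _) _; apply: ler_wpM2l; first exact: sumr_ge0.
by rewrite -[leRHS]mulr1 ler_pdivlMl//; exact: le_trans (cN _) Nw.
Qed.

End arbitrary_norm.

(** * Calculus along segments of [X] and the descent inequality *)

Section descent.
Context {R : realType} {d : nat} {X : set 'rV[R]_d}.
Context {f : 'rV[R]_d -> R} {df : 'rV[R]_d -> 'rV[R]_d}.

Lemma convex_set_segment (x y : 'rV[R]_d) (t : R) :
  convex_set X -> X x -> X y -> 0 <= t <= 1 -> X (x + t *: (y - x)).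
Proof.
move=> cX Xx Xy t01.
have [t0 t1] := andP t01.
have := cX y x (Itv01 t0 t1); rewrite !inE => /(_ Xy Xx).
congr (X _); rewrite /conv/= /unstable.onem.
by rewrite scalerBl scale1r scalerBr addrCA.
Qed.

Lemma gradient_onP x : gradient_on X f df -> X x -> forall e, 0 < e ->
  \forall y \near within X (nbhs x),
    `|f y - f x - dotv (df x) (y - x)| <= e * `|y - x|.
Proof.
move=> fdf Xx e e0.
have /= h := fdf x Xx.
by move/(@eqoP _ _ _ _ (FilterType (within X (nbhs x)) _)) : h => /(_ e e0).
Qed.

(** Chain rule along the segment. Restricting [s] to [[0, 1]] keeps the points in [X], where
    [gradient_on] applies, so the endpoints get one-sided expansions. *)
Lemma gradient_on_segment x y (t : R) : convex_set X -> gradient_on X f df ->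
  X x -> X y -> 0 <= t <= 1 -> forall e : R, 0 < e ->
  \forall s \near within `[0, 1] (nbhs t),
    `|f (x + s *: (y - x)) - f (x + t *: (y - x))
      - (s - t) * dotv (df (x + t *: (y - x))) (y - x)| <= e * `|s - t|.
Proof.
move=> cX fdf Xx Xy t01 e e0; set u := y - x.
(* The added [1] keeps the divisor positive when [x = y]. *)
have M0 : 0 < `|u| + 1 by rewrite ltr_wpDl.
have Xt := convex_set_segment cX Xx Xy t01.
have e1 : 0 < e / (`|u| + 1) by rewrite divr_gt0.
have line : x + s *: u @[s --> t] --> x + t *: u.
  by apply: cvgD; [exact: cvg_cst|apply: cvgZr_tmp; exact: cvg_id].
have := line _ (gradient_onP fdf Xt e1).
rewrite /= !near_simpl => near_t.
rewrite near_withinE; apply: filterS near_t => s /= near_s s01.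
have /near_s : X (x + s *: u) by exact: convex_set_segment.
have -> : x + s *: u - (x + t *: u) = (s - t) *: u.
  by rewrite opprD addrACA subrr add0r scalerBl.
rewrite dotvZr normrZ => /le_trans; apply.
rewrite mulrCA mulrC ler_wpM2r// mulrAC ler_pdivrMr//.
by rewrite ler_pM2l// lerDl.
Qed.

(** The expansion with error factor [1] bounds the increment by [(1 + |c|) * |s - t|], where [c] is
    the slope at [t]. *)
Lemma gradient_on_segment_continuous x y :
  convex_set X -> gradient_on X f df -> X x -> X y ->
  {within `[0, 1], continuous (fun t : R => f (x + t *: (y - x)))}.
Proof.
move=> cX fdf Xx Xy; apply/subspace_continuousP => t /=.
rewrite in_itv/= => t01.
apply/cvgrPdist_le => e e0.
have := gradient_on_segment cX fdf Xx Xy t01 ltr01.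
set c := dotv _ _ => near_t.
have c1 : 0 < 1 + `|c| by rewrite ltr_wpDr.
have near_ts : \forall s \near within `[0, 1] (nbhs t),
    `|t - s| <= e / (1 + `|c|).
  apply: cvg_within.
  have /cvgrPdist_le : s @[s --> t] --> t by exact: cvg_id.
  by apply; exact: divr_gt0.
apply: filterS2 near_t near_ts => s; rewrite (distrC t) => near_s ts.
rewrite distrC; set a := from_subspace _ _ s; set b := from_subspace _ _ t.
rewrite -(subrK ((s - t) * c) (a - b)) (le_trans (ler_normD _ _))//.
apply: (le_trans (lerD near_s (lexx _))).
by rewrite normrM mulrC -mulrDr -ler_pdivlMr.
Qed.

Lemma gradient_on_segment_derive x y (t : R) : convex_set X ->
  gradient_on X f df -> X x -> X y -> t \in `]0, 1[%R ->
  is_derive t 1 (fun t : R => f (x + t *: (y - x)))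
    (dotv (df (x + t *: (y - x))) (y - x)).
Proof.
move=> cX fdf Xx Xy; rewrite in_itv/= => /andP[t0 t1].
set F := fun t : R => _; set c := dotv _ _.
have t01 : 0 <= t <= 1 by rewrite !ltW.
have Fc : h^-1 *: ((F \o shift t) (h *: 1) - F t) @[h --> 0^'] --> c.
  apply/cvgrPdist_le => e e0.
  have := gradient_on_segment cX fdf Xx Xy t01 e0.
  (* At an interior [t] the restriction to [[0, 1]] disappears, which gives a two-sided
     derivative. *)
  rewrite within_interior; last first.
    by rewrite interior_itv/= in_itv/= t0 t1.
  move=> /nbhs0P near_t; rewrite near_withinE; apply: filterS near_t.
  move=> h /= near_h h0; rewrite [_%:A]mulr1.
  move: near_h; rewrite (addrC t h) addrK -/(F _) -/(F _) -/c => near_h.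
  have -> : c - h^-1 *: (F (h + t) - F t)
      = - (h^-1 * (F (h + t) - F t - h * c)).
    by rewrite /GRing.scale/=; field.
  by rewrite normrN normrM normfV ler_pdivrMl ?normr_gt0// (mulrC _ e).
split; first by apply/cvg_ex; exists c.
exact: cvg_lim Fc.
Qed.

(** The mean value theorem replaces the usual integral: [psi] is [f] on the segment minus the
    claimed quadratic upper model, up to a constant, and its derivative is nonpositive. At the
    endpoints only continuity is required, which suits a gradient taken within [X]. *)
Lemma descent (N : 'rV[R]_d -> R) (L : R) x y :
  is_norm N -> convex_set X -> gradient_on X f df ->
  lipschitz_gradient_on N X L df -> X x -> X y ->
  f y <= f x + dotv (df x) (y - x) + L / 2 * N (y - x) ^+ 2.
Proof.
move=> hN cX fdf ldf Xx Xy; set u := y - x.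
pose p t := x + t *: u.
pose a := dotv (df x) u; pose b := L / 2 * N u ^+ 2.
pose psi : R -> R := (f \o p) - (a \*: id + b \*: id ^+ 2).
pose dpsi t := dotv (df (p t)) u - (a + L * N u ^+ 2 * t).
have Xp (t : R) : 0 <= t <= 1 -> X (p t) by exact: convex_set_segment.
have cpsi : {within `[0, 1], continuous psi}.
  have cp := gradient_on_segment_continuous cX fdf Xx Xy.
  move=> t; apply: cvgB; first exact: cp.
  apply: continuous_subspaceT => {}t.
  apply: cvgD; first by apply: cvgMl_tmp; exact: cvg_id.
  by apply: cvgMl_tmp; apply: cvgM; exact: cvg_id.
have dpsiP (t : R) : t \in `]0, 1[%R -> is_derive t 1 psi (dpsi t).
  move=> t01; have fp := gradient_on_segment_derive cX fdf Xx Xy t01.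
  apply: is_derive_eq; rewrite /dpsi; congr (_ - (_ + _)).
    exact: mulr1.
  by rewrite /GRing.scale/= expr1 mulr1 /b; field.
(* Duality and the Lipschitz bound give [dotv (df (p t) - df x) u <= L * t * N u ^+ 2]. *)
have dpsi_le0 (t : R) : 0 <= t <= 1 -> dpsi t <= 0.
  move=> t01; have /andP[t0 _] := t01.
  rewrite /dpsi opprD addrA -dotvBl subr_le0.
  rewrite (le_trans (dotv_le_dual_norm hN _ _))//.
  have := ldf _ _ (Xp _ t01) Xx.
  rewrite /p addrAC subrr add0r (is_normZ hN) ger0_norm// => lip.
  rewrite (le_trans (ler_wpM2r (is_norm_ge0 hN u) lip))//.
  by rewrite expr2; lra.
have [t t01] := MVT ltr01 dpsiP cpsi.
rewrite subr0 mulr1 => psi_incr.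
have : psi 1 <= psi 0.
  rewrite -subr_le0 psi_incr dpsi_le0//.
  by move: t01; rewrite in_itv/= => /andP[/ltW-> /ltW->].
have p0 : p 0 = x by rewrite /p scale0r addr0.
have p1 : p 1 = y by rewrite /p scale1r addrC subrK.
have -> : psi 0 = f (p 0) - (a * 0 + b * (0 * 0)) by [].
have -> : psi 1 = f (p 1) - (a * 1 + b * (1 * 1)) by [].
rewrite p0 p1 -/a -/b; lra.
Qed.

End descent.

(** * Recursions for the weights and the averaged linear models *)

Section heavy_ball.
Context {R : realType} {d : nat}.
Context {f : 'rV[R]_d -> R} {df : 'rV[R]_d -> 'rV[R]_d}.
Context {delta : nat -> R} {x : nat -> 'rV[R]_d}.

Definition linearization (z y : 'rV[R]_d) : R := f z + dotv (df z) (y - z).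

Lemma weightS k tau : (tau <= k)%N ->
  weight delta k.+1 tau = (1 - delta k.+1) * weight delta k tau.
Proof.
move=> tau_k; rewrite /weight; case: ifP => _.
  by rewrite big_nat_recr//= mulrC.
by rewrite big_nat_recr//= mulrA mulrC.
Qed.

(** Positivity of [k] matters: [weight delta 0 0] is an empty product, equal to [1] whatever
    [delta 0] is. *)
Lemma weight_diag k : (0 < k)%N -> weight delta k k = delta k.
Proof. by case: k => // k _; rewrite /weight/= big_geq// mulr1. Qed.

Lemma Phi1 y : Phi f df delta x 1 y = linearization (x 0%N) y.
Proof. by rewrite /Phi big_nat1 /weight/= big_geq// mul1r. Qed.

Lemma PhiS k y : (0 < k)%N -> Phi f df delta x k.+1 y =
  (1 - delta k) * Phi f df delta x k y + delta k * linearization (x k) y.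
Proof.
case: k => // k _; rewrite /Phi [LHS]big_nat_recr//= weight_diag//.
rewrite mulr_sumr; congr (_ + _); apply: eq_big_nat => tau /andP[_ tau_k].
by rewrite weightS// mulrA.
Qed.

(* [Phi k] is affine with gradient [g k], so [v k] minimizes it over [X]. *)
Lemma Phi_sub (X : set 'rV[R]_d) (eta : nat -> R) (g v : nat -> 'rV[R]_d) k :
  delta 0%N = 1 -> HFW X df delta eta x g v ->
  forall y z, Phi f df delta x k.+1 y - Phi f df delta x k.+1 z
    = dotv (g k.+1) y - dotv (g k.+1) z.
Proof.
move=> delta0 [_ _ run] y z.
elim: k => [|k IHk].
  (* Since [delta 0 = 1], [g 1] is the gradient at [x 0], matching the single weight [1] in [Phi] at
     index 1. *)
  have [-> _ _] := run 0%N.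
  rewrite !Phi1 /linearization delta0 subrr scale0r scale1r add0r !dotvBr.
  by ring.
have [-> _ _] := run k.+1.
rewrite !(PhiS _ (ltn0Sn k)) !dotvDl !dotvZl /linearization !dotvBr.
transitivity ((1 - delta k.+1) *
    (Phi f df delta x k.+1 y - Phi f df delta x k.+1 z) +
  delta k.+1 * (dotv (df (x k.+1)) y - dotv (df (x k.+1)) z)); first by ring.
by rewrite IHk; ring.
Qed.

End heavy_ball.

(** * The gap as an attained minimum, and its rate *)

Lemma argmin_on_inf (R : realType) (T : Type) (X : set T) (h : T -> R) v :
  argmin_on X h v -> inf (h @` X) = h v.
Proof.
move=> [Xv vmin]; apply/eqP; rewrite eq_le; apply/andP; split.
  (* The minimizer makes the image nonempty and bounded below, so [inf] is not its default value. *)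
  by apply: ge_inf; [exists (h v) => _ [u Xu <-]; exact: vmin|exists v].
apply: lb_le_inf; first by exists (h v); exists v.
by move=> _ [u Xu <-]; exact: vmin.
Qed.

Theorem theorem1 (R : realType) (d : nat) (N : 'rV[R]_d -> R)
    (X : set 'rV[R]_d) (D L : R)
    (f : 'rV[R]_d -> R) (df : 'rV[R]_d -> 'rV[R]_d)
    (delta eta : nat -> R) (x g v : nat -> 'rV[R]_d)
    (hN : is_norm N)
    (X_nonempty : X !=set0) (X_convex : convex_set X) (X_compact : compact X)
    (X_diam : forall y z, X y -> X z -> N (y - z) <= D)
    (f_convex : convex_function X f)
    (f_grad : gradient_on X f df)
    (L_ge0 : 0 <= L) (df_lip : lipschitz_gradient_on N X L df)
    (delta_def : forall k, delta k = 2 / (k%:R + 2))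
    (eta_def : forall k, eta k = 2 / (k%:R + 2))
    (run : HFW X df delta eta x g v) :
  forall k : nat, (1 <= k)%N ->
    FW_gap X f df delta x k = f (x k) - Phi f df delta x k (v k) /\
    FW_gap X f df delta x k <= 2 * L * D ^+ 2 / (k%:R + 1).
Proof.
have delta0 : delta 0%N = 1 by rewrite delta_def add0r divff.
have [Xx0 _ step] := run.
have vmin k : argmin_on X (Phi f df delta x k.+1) (v k.+1).
  have [_ [Xv gmin] _] := step k; split=> // u Xu.
  by rewrite -subr_le0 (Phi_sub k delta0 run) subr_le0 gmin.
have Xv k : X (v k.+1) by case: (vmin k).
have gapE k : FW_gap X f df delta x k.+1
    = f (x k.+1) - Phi f df delta x k.+1 (v k.+1).
  by rewrite /FW_gap (argmin_on_inf (vmin k)).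
have eta01 k : 0 <= eta k <= 1.
  have k0 : 0 <= k%:R :> R by exact: ler0n.
  by rewrite eta_def ler_pdivrMr ?divr_ge0//; lra.
have xS k : x k.+1 = x k + eta k *: (v k.+1 - x k).
  have [_ _ ->] := step k.
  by rewrite scalerBl scale1r scalerBr addrAC addrA.
have Xx k : X (x k).
  by elim: k => // k IHk; rewrite xS; exact: convex_set_segment.
(* The sign of [D] is what allows the diameter bound to be squared below. *)
have D_ge0 : 0 <= D := le_trans (is_norm_ge0 hN _) (X_diam _ _ Xx0 Xx0).
have progress k : f (x k.+1) <= (1 - delta k) * f (x k)
    + delta k * linearization (f := f) (df := df) (x k) (v k.+1)
    + L / 2 * D ^+ 2 * delta k ^+ 2.
  have /andP[eta0 _] := eta01 k.
  have := descent hN X_convex f_grad df_lip (Xx k) (Xx k.+1).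
  have -> : x k.+1 - x k = eta k *: (v k.+1 - x k).
    by rewrite xS addrAC subrr add0r.
  rewrite dotvZr (is_normZ hN) ger0_norm//.
  have -> : delta k = eta k by rewrite delta_def eta_def.
  move=> /le_trans; apply; rewrite /linearization exprMn.
  have ND : N (v k.+1 - x k) ^+ 2 <= D ^+ 2.
    by rewrite ler_sqr ?nnegrE ?is_norm_ge0// X_diam.
  have : L / 2 * eta k ^+ 2 * N (v k.+1 - x k) ^+ 2 <=
         L / 2 * eta k ^+ 2 * D ^+ 2.
    by rewrite ler_wpM2l// mulr_ge0 ?sqr_ge0// divr_ge0.
  lra.
case=> // k _; split=> //; rewrite gapE.
have LD : 0 <= L * D ^+ 2 by rewrite mulr_ge0// sqr_ge0.
(* The induction starts at the gap of index 1: [delta 0 = 1] cancels [f (x 0)] and leaves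
   [L * D ^+ 2 / 2], half of the claimed bound. *)
elim: k => [|k IHk].
  have := progress 0%N; rewrite Phi1 delta0 expr1n.
  have -> : 2 * L * D ^+ 2 / (1%:R + 1) = L * D ^+ 2 by field.
  lra.
have d_le1 : 0 <= 1 - delta k.+1.
  by have /andP[_] := eta01 k.+1; rewrite subr_ge0 delta_def eta_def.
(* The old model at the new vertex is at least its minimum, so the old gap can enter the
   recursion. *)
have v_opt := ler_wpM2l d_le1 ((vmin k).2 _ (Xv k.+1)).
have gap_step := ler_wpM2l d_le1 IHk.
rewrite PhiS//; have := progress k.+1.
set l := linearization _ _ => pk.
suff : (1 - delta k.+1) * (2 * L * D ^+ 2 / (k.+1%:R + 1))
    + L / 2 * D ^+ 2 * delta k.+1 ^+ 2 <= 2 * L * D ^+ 2 / (k.+2%:R + 1).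
  lra.
rewrite delta_def -!(natr1 k.+1) -!(natr1 k).
have k0 : 0 <= k%:R :> R by exact: ler0n.
move: (k%:R) k0 => n n0.
rewrite -subr_ge0.
(* The slack in the induction step has a closed form that is visibly nonnegative. *)
have -> : 2 * L * D ^+ 2 / (n + 1 + 1 + 1) -
  ((1 - 2 / (n + 1 + 2)) * (2 * L * D ^+ 2 / (n + 1 + 1)) +
   L / 2 * D ^+ 2 * (2 / (n + 1 + 2)) ^+ 2) =
  2 * (L * D ^+ 2) / ((n + 2) * (n + 3) ^+ 2).
  by field; apply/andP; split; lra.
by rewrite divr_ge0// mulr_ge0// ?sqr_ge0//; lra.
Qed.
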